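(* Let $r\in\mathbb{Q}$ and let $n\geq 1$ be an integer. Suppose that $\cos^n(r\pi)$ is rational. Then \[\cos(r\pi)\in\left\{0,\ \pm 1,\ \pm\frac{1}{2},\ \pm\frac{\sqrt{3}}{2},\ \pm\frac{\sqrt{2}}{2}\right\}.\]
   Context: Here $\cos^n(r\pi)$ denotes the $n$-th power $(\cos(r\pi))^n$. *)

(* Defs.v *)
From mathcomp Require Export all_boot all_order all_algebra.
From mathcomp Require Export reals trigo.

(* Main.v *)
(* Put y = 4 cos^2(r pi) = 2 + 2 cos(2 r pi). With D_N the monic integer
   polynomial such that D_N(z + 1/z) = z^N + 1/z^N, the number y is a root of
   D_N(X - 2) - 2 for N the denominator of r. Every complex root of that
   polynomial has the form 2 + z + 1/z = |1 + z|^2 with z^N = 1, so it is real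
   and nonnegative. If y^n is a rational a, then y is the only complex root of
   the gcd of X^n - a and D_N(X - 2) - 2, because a nonnegative n-th root is
   unique; the sum of the roots of this rational polynomial is a multiple of y,
   so y is rational. Being an algebraic integer in [0, 4], y is one of
   0, 1, 2, 3, 4. *)
Require Import Defs.
From mathcomp Require Import all_field complex ring.
Import Order.TTheory GRing.Theory Num.Theory.
Local Open Scope ring_scope.

(** Dickson polynomials of the first kind with parameter 1, that is [2 T_n(X/2)] for the Chebyshev
    [T_n]. The ring is arbitrary so that they can be carried between [rat], [R], [R[i]] and
    [algC]. *)
Fixpoint dickson (R : comNzRingType) (n : nat) : {poly R} :=
  match n with
  | 0 => 2%:P
  | 1 => 'X
  | (m.+1 as k).+1 => 'X * dickson R k - dickson R m
  end.

Lemma dicksonSS (R : comNzRingType) n :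
  dickson R n.+2 = 'X * dickson R n.+1 - dickson R n.
Proof. by []. Qed.

Lemma nat_ind2 (P : nat -> Prop) :
  P 0%N -> P 1%N -> (forall n, P n -> P n.+1 -> P n.+2) -> forall n, P n.
Proof.
move=> P0 P1 PSS n; suff [] : P n /\ P n.+1 by [].
by elim: n => [//|n [Pn PSn]]; split=> //; apply: PSS.
Qed.

Lemma map_dickson (R S : comNzRingType) (f : {rmorphism R -> S}) n :
  map_poly f (dickson R n) = dickson S n.
Proof.
elim/nat_ind2: n => [||n IH0 IH1].
- by rewrite /= map_polyC /= rmorph_nat.
- by rewrite /= map_polyX.
- by rewrite !dicksonSS rmorphB rmorphM /= map_polyX IH0 IH1.
Qed.

(** The size is carried through the induction because it shows that ['X * dickson R n.+2] supplies
    the leading term. The index starts at 1, as [dickson R 0] is the constant 2. *)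
Lemma dickson_monic_size (R : comNzRingType) n :
  dickson R n.+1 \is monic /\ size (dickson R n.+1) = n.+2.
Proof.
elim/nat_ind2: n => [||n [_ s0] [m1 s1]].
- by rewrite monicX size_polyX.
- rewrite dicksonSS /= -expr2.
  have s : (size (- 2%:P : {poly R}) < size ('X^2 : {poly R}))%N.
    by rewrite size_polyN size_polyXn (leq_ltn_trans (size_polyC_leq1 _)).
  by rewrite monicE lead_coefDl // lead_coefXn size_polyDl // size_polyXn.
- have sX : size ('X * dickson R n.+2) = n.+4.
    by rewrite mulrC size_mulX ?monic_neq0 // s1.
  have s : (size (- dickson R n.+1) < size ('X * dickson R n.+2)%R)%N.
    by rewrite size_polyN s0 sX.
  rewrite dicksonSS size_polyDl // sX; split=> //.
  by rewrite monicE lead_coefDl // mulrC lead_coefMX; exact: m1.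
Qed.

Lemma dickson_sub2_monic (R : comNzRingType) n :
  dickson R n.+1 - 2%:P \is monic.
Proof.
have [m s] := dickson_monic_size R n.
by rewrite monicE lead_coefDl // size_polyN s (leq_ltn_trans (size_polyC_leq1 _)).
Qed.

Lemma horner_dickson (R : comNzRingType) (z w : R) n :
  z * w = 1 -> (dickson R n).[z + w] = z ^+ n + w ^+ n.
Proof.
move=> zw1; elim/nat_ind2: n => [||n IH0 IH1].
- by rewrite /= hornerC.
- by rewrite /= hornerX.
- rewrite dicksonSS hornerD hornerN mulrC hornerMX IH0 IH1 !exprS.
  have -> : (z * z ^+ n + w * w ^+ n) * (z + w) =
    z * (z * z ^+ n) + w * (w * w ^+ n) + (z * w) * (z ^+ n + w ^+ n) by ring.
  by rewrite zw1 mul1r addrK.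
Qed.

Lemma horner_dickson_cos (R : realType) (t : R) n :
  (dickson R n).[2 * cos t] = 2 * cos (n%:R * t).
Proof.
elim/nat_ind2: n => [||n IH0 IH1].
- by rewrite /= hornerC mul0r cos0 mulr1.
- by rewrite /= hornerX mul1r.
- rewrite dicksonSS hornerD hornerN mulrC hornerMX IH0 IH1.
  have -> : n%:R * t = n.+1%:R * t - t by rewrite -natr1; ring.
  have -> : n.+2%:R * t = n.+1%:R * t + t by rewrite -[n.+2%:R]natr1; ring.
  by rewrite !cosD cosN sinN; ring.
Qed.

Arguments dickson : simpl never.

Lemma dickson_sub2_root_ge0 (C : numClosedFieldType) (w : C) n :
  (dickson C n.+1).[w] = 2 -> 0 <= w + 2.
Proof.
move=> Dw2.
have [z zw] : exists z : C, z * (w - z) = 1.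
  (* Take [z] with [z^2 = w z - 1]; then [w - z] is its inverse. *)
  have [z] := @solve_monicpoly C 2 (fun i => if i is 0 then -1 else w) isT.
  rewrite big_ord_recl big_ord1 /= expr0 expr1 => z2.
  by exists z; rewrite mulrBr -expr2 z2; ring.
have z0 : z != 0 by apply: contra_eq_neq zw => ->; rewrite mul0r eq_sym oner_neq0.
have wz : w - z = z^-1 by rewrite -[RHS]mulr1 -zw mulKf.
(* With [Z = z ^+ n.+1], the equation [Z + 1/Z = 2] says [(Z - 1)^2 = 0]. *)
have zn1 : z ^+ n.+1 = 1.
  have := horner_dickson C z (w - z) n.+1 zw.
  rewrite subrKC Dw2 wz exprVn => Z2; apply/eqP.
  rewrite -subr_eq0 -sqrf_eq0; apply/eqP.
  have Z0 : z ^+ n.+1 != 0 by rewrite expf_neq0.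
  have : 2 * z ^+ n.+1 = z ^+ n.+1 * z ^+ n.+1 + 1.
    by rewrite {1}Z2 mulrDl mulVf.
  move: (z ^+ n.+1) => Z e.
  have -> : (Z - 1) ^+ 2 = Z * Z + 1 - 2 * Z by ring.
  by rewrite e subrr.
have nz : `|z| = 1.
  by apply/eqP; rewrite -(@pexpr_eq1 _ _ n.+1) // -normrX zn1 normr1.
have zc : z^-1 = z^* by rewrite invC_norm nz expr1n invr1 mul1r.
have -> : w + 2 = `|1 + z| ^+ 2.
  rewrite normCK rmorphD rmorph1 /= -zc -[w](subrK z) wz.
  by rewrite mulrDr mulr1 mulrDl mulfV //; ring.
exact: exprn_ge0.
Qed.

Lemma rat_single_root (C : numClosedFieldType) (p : {poly rat}) (y : C) :
  p != 0 -> root (map_poly ratr p) y ->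
  (forall w, root (map_poly ratr p) w -> w = y) ->
  exists q : rat, y = ratr q.
Proof.
move=> p0 py pw.
set P := map_poly ratr p in py pw *.
have P0 : P != 0 by rewrite map_poly_eq0.
have [s Ps] := closed_field_poly_normal P.
have l0 : lead_coef P != 0 by rewrite lead_coef_eq0.
have rP w : root P w = (w \in s).
  by rewrite Ps rootZ // root_prod_XsubC.
have s0 : size s != 0%N.
  by rewrite size_eq0; apply: contraL py => /eqP s0; rewrite rP s0.
have sumE : \sum_(w <- s) w = y *+ size s.
  rewrite big_seq (eq_bigr (fun=> y)) => [|w ws]; last by apply: pw; rewrite rP.
  by rewrite -big_seq big_const_seq count_predT iter_addr_0.
(* Vieta: the roots, with multiplicity, are [size s] copies of [y], and [size s] is invertible in
   characteristic 0. *)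
have : P`_(size s).-1 = lead_coef P * - (y *+ size s).
  by rewrite {1}Ps coefZ coefPn_prod_XsubC // sumE.
rewrite coef_map lead_coef_map /= => e.
exists (- p`_(size s).-1 / lead_coef p / (size s)%:R).
have lp : ratr (lead_coef p) != 0 :> C by rewrite -lead_coef_map.
have sC : (size s)%:R != 0 :> C by rewrite pnatr_eq0.
rewrite !(fmorph_div, rmorphN, rmorph_nat) /= e -mulr_natr.
by field; rewrite lp sC.
Qed.

(** Such a [q] is a root of a monic integer polynomial, and a rational algebraic integer is an
    integer. *)
Lemma rat_dickson_int (q : rat) n :
  (dickson rat n.+1).[q] = 2 -> exists m : int, q = m%:~R.
Proof.
move=> Dq.
have qA : (ratr q : algC) \in Aint.
  apply: (@root_monic_Aint (dickson algC n.+1 - 2%:P)).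
  - rewrite rootE hornerD hornerN hornerC -(map_dickson _ _ ratr).
    by rewrite horner_map /= Dq rmorph_nat subrr.
  - exact: dickson_sub2_monic.
  - apply/polyOverP => i.
    rewrite coefB coefC -(map_dickson _ _ intr).
    by rewrite coef_map /= rpredB ?intr_int //; case: ifP => _; rewrite ?rpred_nat ?rpred0.
have /intrP [m qm] := Cint_rat_Aint (Crat_rat q) qA.
exists m; apply: (fmorph_inj (ratr : {rmorphism rat -> algC})).
by rewrite /= qm ratr_int.
Qed.

Lemma dickson_root_power_int (R : rcfType) (u : R) (a : rat) k n :
  (dickson R k.+1).[u] = 2 -> (u + 2) ^+ n.+1 = ratr a ->
  exists m : int, u = m%:~R.
Proof.
move=> Du ua.
pose f : {rmorphism R -> R[i]} := real_complex R.
pose y : R[i] := f (u + 2).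
have Df : (dickson R[i] k.+1).[y - 2] = 2.
  rewrite /y rmorphD rmorph_nat addrK -(map_dickson _ _ f) horner_map /=.
  by rewrite Du rmorph_nat.
have y0 : 0 <= y by rewrite -[y](subrK 2); apply: dickson_sub2_root_ge0 Df.
have yn : y ^+ n.+1 = ratr a by rewrite -rmorphXn ua fmorph_rat.
(* The gcd is formed over [rat], where both polynomials live. Since gcds commute with field
   extension, its roots in [R[i]] are exactly the common roots. *)
pose p := gcdp ('X^(n.+1) - a%:P) ((dickson rat k.+1 - 2%:P) \Po ('X - 2%:P)).
have rp w : root (map_poly ratr p) w =
    (w ^+ n.+1 == ratr a) && ((dickson R[i] k.+1).[w - 2] == 2).
  rewrite /p gcdp_map root_gcd rmorphB /= map_polyXn map_polyC /=.
  rewrite map_comp_poly !rmorphB /= map_polyX !map_polyC /= rmorph_nat.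
  rewrite map_dickson !rootE comp_polyC !hornerE horner_comp !hornerE.
  by rewrite !subr_eq0.
have [||w|q yq] := @rat_single_root R[i] p y.
- by rewrite gcdp_eq0 negb_and -size_poly_eq0 size_XnsubC.
- by rewrite rp yn Df !eqxx.
- rewrite rp => /andP[/eqP wn /eqP Dw].
  have w0 : 0 <= w by rewrite -[w](subrK 2); apply: dickson_sub2_root_ge0 Dw.
  (* Nonnegative elements with equal [n.+1]-th powers coincide. *)
  by apply/eqP; rewrite -(@eqrXn2 _ n.+1) // wn yn.
have uq : u = ratr (q - 2).
  apply: (fmorph_inj f); rewrite fmorph_rat rmorphB /= rmorph_nat -yq /y.
  by rewrite rmorphD rmorph_nat addrK.
have [|m qm] := rat_dickson_int (q - 2) k.
  apply: (fmorph_inj (ratr : {rmorphism rat -> R})).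
  by rewrite -horner_map map_dickson /= -uq Du rmorph_nat.
by exists m; rewrite uq qm ratr_int.
Qed.

Lemma cos_int_mul_2pi (R : realType) (m : int) : cos (m%:~R * (pi *+ 2) : R) = 1.
Proof.
suff nat_case k : cos (k%:R * (pi *+ 2) : R) = 1.
  case: m => k; first exact: nat_case.
  by rewrite NegzE mulrNz mulNr cosN; exact: nat_case.
by rewrite mulr_natl; elim: k => [|k IH]; rewrite ?mulr0n ?cos0 // mulrS addrC;
  rewrite cosD cos2pi sin2pi mulr0 subr0 mulr1.
Qed.

Theorem theorem11 (R : realType) (r : rat) (n : nat) :
  (1 <= n)%N ->
  rational (cos (ratr r * pi : R) ^+ n) ->
  cos (ratr r * pi : R) \in
    [:: 0; 1; -1; 1 / 2; - (1 / 2); Num.sqrt 3 / 2; - (Num.sqrt 3 / 2);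
        Num.sqrt 2 / 2; - (Num.sqrt 2 / 2)].
Proof.
case: n => // n _ [q _ qE].
set t : R := ratr r * pi in qE *.
have cos2t : 2 * cos (t *+ 2) + 2 = 4 * cos t ^+ 2 by rewrite cos_mulr2n; ring.
have [k dk] : exists k : nat, denq r = k.+1.
  by exists `|denq r|.-1; have := denq_gt0 r; case: (denq r) => // -[].
(* Here [k.+1] is the denominator of [r], so [k.+1 * 2t] is an integer multiple of [2 pi]. The
   rational [4 ^+ n.+1 * q ^+ 2] is [(4 cos^2 t) ^+ n.+1], with [q] the given power of [cos t]. *)
have [||m um] := @dickson_root_power_int R (2 * cos (t *+ 2))
  (4 ^+ n.+1 * q ^+ 2) k n.
- rewrite horner_dickson_cos.
  have -> : k.+1%:R * (t *+ 2) = (numq r)%:~R * (pi *+ 2) :> R.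
    rewrite /t -[in LHS](divq_num_den r) fmorph_div /= !ratr_int dk.
    by rewrite -pmulrn mulrnAr mulrA mulrCA divff ?pnatr_eq0 // mulr1 -mulrnAr.
  by rewrite cos_int_mul_2pi mulr1.
- by rewrite cos2t exprMn rmorphM !rmorphXn /= rmorph_nat qE -!exprM mulnC.
have c2 : 4 * cos t ^+ 2 = (m + 2)%:~R by rewrite -cos2t um rmorphD.
have j_ge0 : 0 <= m + 2 by rewrite -(ler0z R) -c2 mulr_ge0 // sqr_ge0.
(* [4 - 4 cos^2 t = 4 sin^2 t] is nonnegative. *)
have j_le4 : m + 2 <= 4.
  rewrite -(ler_int R) -c2 -subr_ge0 -[4%:~R]mulr1 -mulrBr -sin2cos2.
  by rewrite mulr_ge0 // sqr_ge0.
have sqrE (x : R) : 4 * x ^+ 2 = (m + 2)%:~R -> (cos t == x) || (cos t == - x).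
  move=> x2; rewrite -eqf_sqr; apply/eqP.
  by apply: (@mulfI _ 4); rewrite ?pnatr_eq0 // c2 x2.
have sqrt_half (j : nat) : 4 * (Num.sqrt j%:R / 2) ^+ 2 = j%:R :> R.
  by rewrite exprMn sqr_sqrtr ?ler0n //; field.
(* It remains to solve [4 cos^2 t = j] for [j] = 0, 1, 2, 3, 4, exhibiting one root [x] each time;
   [sqrE] then gives [cos t = x] or [cos t = -x]. *)
move: (m + 2) j_ge0 j_le4 sqrE => [j|j] // _; rewrite !inE.
case: j => [|[|[|[|[|j]]]]] // _ sqrE.
- by have /orP[] := sqrE 0 ltac:(by rewrite expr0n mulr0); rewrite ?oppr0 => ->.
- by have /orP[] := sqrE (1 / 2) ltac:(by field); move=> ->; rewrite ?orbT.
- by have /orP[] := sqrE _ (sqrt_half 2); move=> ->; rewrite ?orbT.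
- by have /orP[] := sqrE _ (sqrt_half 3); move=> ->; rewrite ?orbT.
- by have /orP[] := sqrE 1 ltac:(by rewrite expr1n mulr1); move=> ->; rewrite ?orbT.
Qed.
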